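(* Let $X$ be a real Hilbert space and let $A:X\to 2^X$ be a monotone linear relation. Let $V\subset X$ satisfy (i) $V$ is a closed subspace of $X$, (ii) $\operatorname{dom}A\subset V$, and (iii) $A0\subset V^\perp$. Then the operator $\tilde A:V\to 2^V$ with $\operatorname{dom}\tilde A=\operatorname{dom}A$, defined by $\tilde Ax:=P_V Ax$ for $x\in\operatorname{dom}A$, is a single-valued monotone linear relation. In the case where $V=(A0)^\perp$ and $A0$ is closed, the operator $\tilde A$ is a single-valued selection of $A$. If $A$ is maximal monotone, then $V=(A0)^\perp=\overline{\operatorname{dom}A}$ is the only subspace satisfying conditions (i)--(iii), and $\tilde A$ is a maximal monotone (as an operator on the Hilbert space $V$) single-valued selection of $A$.
   Context: For a set-valued operator $T:X\to 2^X$: $\operatorname{dom}T=\{x:Tx\neq\emptyset\}$ and $\operatorname{gra}T=\{(x,x^* ):x\in\operatorname{dom}T,\ x^*\in Tx\}$. $T$ is monotone if $\langle x-y,x^*-y^*\rangle\ge0$ for all $(x,x^* ),(y,y^* )\in\operatorname{gra}T$; it is maximal monotone if it is monotone and its graph has no proper monotone extension. $T$ is single-valued if $Tx$ contains at most one element for every $x$. A selection of $T$ is an operator $\tilde T$ with $\operatorname{gra}\tilde T\subset\operatorname{gra}T$. $A:X\to 2^X$ is a linear relation if $\operatorname{dom}A$ is a linear subspace of $X$ and, for all $x,y\in\operatorname{dom}A$ and $\lambda\in\mathbb{R}$, $\lambda Ax\subset A(\lambda x)$ and $Ax+Ay\subset A(x+y)$ (equivalently, $\operatorname{gra}A$ is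 a linear subspace of $X\times X$). $A0$ denotes the set $A(0)$. $C^\perp=\{x\in X:\langle x,c\rangle=0\ \forall c\in C\}$. $P_V$ is the metric (orthogonal) projection onto the closed subspace $V$, and $P_VAx=\{P_Vx^*:x^*\in Ax\}$. *)

(* Defs.v *)
From HB Require Import structures.
From mathcomp Require Import all_boot all_order all_algebra.
From mathcomp Require Import all_classical all_reals all_analysis.
Set Implicit Arguments.
Unset Strict Implicit.
Unset Printing Implicit Defensive.
Import Order.TTheory GRing.Theory Num.Theory.
Import numFieldNormedType.Exports.
Local Open Scope classical_set_scope.
Local Open Scope ring_scope.

(* A set-valued operator T : X -> 2^X is a function [T : X -> set X].        *)
Definition dom (X : Type) (T : X -> set X) : set X := [set x | T x !=set0].

Definition gra (X : Type) (T : X -> set X) : set (X * X) :=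
  [set p | dom T p.1 /\ T p.1 p.2].

Definition single_valued (X : Type) (T : X -> set X) : Prop :=
  forall x u v, T x u -> T x v -> u = v.

Definition selection (X : Type) (T' T : X -> set X) : Prop :=
  gra T' `<=` gra T.

(* T is an operator from V to 2^V.  Such operators, for V a closed subspace  *)
(* of a Hilbert space X, are represented by operators on X whose graph lies  *)
(* in V x V; V carries the inner product and the linear structure of X.      *)
Definition operator_on (X : Type) (V : set X) (T : X -> set X) : Prop :=
  gra T `<=` V `*` V.

Definition linear_subspace (R : realType) (X : lmodType R) (V : set X) : Prop :=
  GRing.submod_closed [in V].

Definition linear_relation (R : realType) (X : lmodType R) (A : X -> set X)
    : Prop :=
  [/\ linear_subspace (dom A),
      forall (a : R) x, dom A x -> [set a *: u | u in A x] `<=` A (a *: x) &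
      forall x y, dom A x -> dom A y ->
        [set u + v | u in A x & v in A y] `<=` A (x + y)].

Definition monotone_op (R : realType) (X : lmodType R) (ip : {dot X for idfun})
    (T : X -> set X) : Prop :=
  forall x u y v, gra T (x, u) -> gra T (y, v) -> 0 <= ip (x - y) (u - v).

(* Maximal monotonicity of T as an operator from V to 2^V: only monotone     *)
(* extensions with graph in V x V compete.                                   *)
Definition maximal_monotone_on (R : realType) (X : lmodType R)
    (ip : {dot X for idfun}) (V : set X) (T : X -> set X) : Prop :=
  [/\ operator_on V T, monotone_op ip T &
      forall T' : X -> set X, operator_on V T' -> monotone_op ip T' ->
        gra T `<=` gra T' -> gra T' = gra T].

Definition maximal_monotone (R : realType) (X : lmodType R)
    (ip : {dot X for idfun}) (T : X -> set X) : Prop :=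
  maximal_monotone_on ip setT T.

Definition orth (R : realType) (X : lmodType R) (ip : {dot X for idfun})
    (C : set X) : set X :=
  [set x | forall c, C c -> ip x c = 0].

(* [metric_proj V x] is the point of V nearest to x; the default value 0 is  *)
(* never used when X is a Hilbert space and V is a closed subspace.          *)
Definition metric_proj (R : realType) (X : normedModType R) (V : set X) (x : X)
    : X :=
  xget 0 [set p | V p /\ forall v, V v -> `|x - p| <= `|x - v|].

(* x |-> P_V (A x); it is empty at every x outside dom A, so its domain is   *)
(* dom A.                                                                    *)
Definition proj_op (R : realType) (X : normedModType R) (V : set X)
    (A : X -> set X) : X -> set X :=
  fun x => metric_proj V @` A x.

Definition admissible (R : realType) (X : normedModType R)
    (ip : {dot X for idfun}) (A : X -> set X) (V : set X) : Prop :=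
  [/\ linear_subspace V /\ closed V, dom A `<=` V & A 0 `<=` orth ip V].

(* Main.v *)
Require Import Defs.
From HB Require Import structures.
From mathcomp Require Import all_boot all_order all_algebra.
From mathcomp Require Import all_classical all_reals all_analysis.
From mathcomp Require Import ring lra.
Set Implicit Arguments.
Unset Strict Implicit.
Unset Printing Implicit Defensive.
Import Order.TTheory GRing.Theory Num.Theory.
Import numFieldNormedType.Exports.
Local Open Scope classical_set_scope.
Local Open Scope ring_scope.

(** The whole statement rests on one observation: for [x - y] in [V], the
    products [<x - y, u>] and [<x - y, P_V u>] agree, because [u - P_V u] is
    orthogonal to [V].  Projecting the values of [A] therefore does not change
    monotonicity tests between points of [V], and [dom A] lies in [V].  The
    values of a linear relation are translates of [A 0], which [P_V] sends to
    [0] as soon as [A 0] is orthogonal to [V]: so the projected operator is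
    single-valued.  If moreover [V] is the orthogonal of a closed [A 0], then
    [u - P_V u] lies in the bi-orthogonal of [A 0], that is in [A 0], and
    subtracting it from [u] does not leave [A x]: projecting selects.

    For a maximal monotone [A] everything follows from the equality
    [A 0 = (dom A)^\perp] ([maximal_value0]).  Monotonicity and linearity give
    one inclusion; for the other, a vector [w] orthogonal to [dom A] makes
    [(0, w)] monotonically related to the graph of [A].  Taking orthogonals,
    [(A 0)^\perp] is the closure of [dom A], and an admissible subspace is
    squeezed between these two descriptions.  Maximality of the projection in
    [V] is the initial observation read backwards: what is monotonically
    related to the projected graph within [V] is monotonically related to the
    graph of [A].

    The Hilbert space facts used are the projection theorem
    ([exists_nearest], [nearest_orth]) and its consequence that the
    bi-orthogonal of a subspace is its closure ([orth_orth]). *)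

(** * Subspaces and orthogonals *)

Section Orthogonal.
Variables (R : realType) (X : lmodType R) (ip : {dot X for idfun}).
Implicit Types (V C : set X) (x y : X).

Lemma linear_subspaceP V :
  linear_subspace V <->
  V 0 /\ forall (a : R) x y, V x -> V y -> V (a *: x + y).
Proof.
split=> [[V0 VL]|[V0 VL]]; split.
- exact: set_mem V0.
- move=> a x y Vx Vy; apply: set_mem; apply: VL; exact: mem_set.
- exact: mem_set.
- by move=> a x y /set_mem Vx /set_mem Vy; apply: mem_set; apply: VL.
Qed.

Lemma linear_subspace_scale V (a : R) x :
  linear_subspace V -> V x -> V (a *: x).
Proof.
by move=> /linear_subspaceP[V0 VL] Vx; rewrite -[_ *: _]addr0; apply: VL.
Qed.

Lemma linear_subspaceD V x y : linear_subspace V -> V x -> V y -> V (x + y).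
Proof.
by move=> /linear_subspaceP[V0 VL] Vx; rewrite -[x]scale1r; apply: VL.
Qed.

Lemma linear_subspaceB V x y : linear_subspace V -> V x -> V y -> V (x - y).
Proof.
move=> VS Vx Vy; apply: linear_subspaceD => //.
by rewrite -scaleN1r; apply: linear_subspace_scale.
Qed.

Lemma dotC x y : ip x y = ip y x.
Proof. by rewrite hermC expr0 mul1r. Qed.

Lemma dot_eq0 x : ip x x = 0 -> x = 0.
Proof.
move=> x0; apply/eqP; apply: contraT => /(@neq0_dnorm_gt0 _ _ _ ip).
by rewrite x0 ltxx.
Qed.

Lemma orth_subspace C : linear_subspace (orth ip C).
Proof.
apply/linear_subspaceP; split=> [c _|a x y xC yC c Cc].
  by rewrite linear0l.
by rewrite linearDl linearZl_LR /= xC// yC// mulr0 addr0.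
Qed.

Lemma orthS C V : C `<=` V -> orth ip V `<=` orth ip C.
Proof. by move=> CV x xV c /CV; apply: xV. Qed.

Lemma orth_sym C V : C `<=` orth ip V -> V `<=` orth ip C.
Proof. by move=> CV x Vx c /CV/(_ _ Vx); rewrite dotC. Qed.

Lemma orth_disjoint V x : V x -> orth ip V x -> x = 0.
Proof. by move=> Vx xV; apply: dot_eq0; apply: xV. Qed.

End Orthogonal.

(** * Orthogonal projection in a Hilbert space *)

Section HilbertProjection.
Variables (R : realType) (X : completeNormedModType R).
Variables (ip : {dot X for idfun}) (normE : forall x : X, `|x| ^+ 2 = ip x x).
Implicit Types (V C : set X) (x y p : X).

Lemma sqr_normD x y : `|x + y| ^+ 2 = `|x| ^+ 2 + `|y| ^+ 2 + ip x y *+ 2.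
Proof.
rewrite !normE linearDl !linearDr /= (dotC ip y x).
by move: (ip x x) (ip x y) (ip y y) => a b c; ring.
Qed.

Lemma sqr_normB x y : `|x - y| ^+ 2 = `|x| ^+ 2 + `|y| ^+ 2 - ip x y *+ 2.
Proof. by rewrite sqr_normD normrN linearNr mulNrn. Qed.

(** The norm is continuous, and polarization transfers this to the inner
    product without going through the Cauchy-Schwarz inequality. *)
Lemma dot_continuous c : continuous (fun x => ip x c).
Proof.
have -> : (fun x => ip x c) =
    (fun x => 4^-1 * (`|x + c| * `|x + c| - `|x - c| * `|x - c|)).
  apply/funext => x; have := sqr_normD x c; have := sqr_normB x c.
  rewrite !expr2 => -> ->.
  by move: (ip x c) (`|x| * _) (`|c| * _) => a b d; field.
move=> x; apply: cvgM; first exact: cvg_cst.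
by apply: cvgB; apply: cvgM; apply: cvg_norm; apply: cvgD;
  (exact: cvg_id || exact: cvg_cst).
Qed.

Lemma orth_closed C : closed (orth ip C).
Proof.
rewrite (_ : orth ip C = \bigcap_(c in C) ((fun x => ip x c) @^-1` [set 0])).
  apply: closed_bigI => c _; apply: preimage_closed; last exact: closed_eq.
  by move=> x _; apply: dot_continuous.
by apply/seteqP; split=> x xC c; apply: xC.
Qed.

Lemma closure_subspace V : linear_subspace V -> linear_subspace (closure V).
Proof.
move=> /linear_subspaceP[V0 VL]; apply/linear_subspaceP.
split=> [|a x y xV yV B nB]; first exact: subset_closure.
have : (fun z : X * X => a *: z.1 + z.2) z @[z --> (x, y)] --> a *: x + y.
  by apply: cvgD; [apply: cvgZr; exact: cvg_fst|exact: cvg_snd].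
move=> /(_ B nB)[[P Q] [/= nP nQ] PQB].
have [u [Vu Pu]] := xV P nP; have [v [Vv Qv]] := yV Q nQ.
by exists (a *: u + v); split; [apply: VL|apply: (PQB (u, v))].
Qed.

(** Almost nearest points to [x] are close to each other: their midpoint lies
    in [C], so it is not much nearer to [x], and the parallelogram identity
    bounds their distance.  Hence the sets of almost nearest points generate a
    Cauchy filter. *)
Lemma exists_nearest C x : closed C -> C !=set0 ->
  (forall u v, C u -> C v -> C (2^-1 *: (u + v))) ->
  exists p, C p /\ forall v, C v -> `|x - p| <= `|x - v|.
Proof.
move=> clC [c0 Cc0] midC.
pose D := [set `|x - v| ^+ 2 | v in C].
have infD : has_inf D.
  split; first by exists (`|x - c0| ^+ 2), c0.
  by exists 0 => _ [v _ <-]; apply: sqr_ge0.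
have lbD v : C v -> inf D <= `|x - v| ^+ 2.
  by move=> Cv; apply: ge_inf; [exact: infD.2|exists v].
pose S (e : R) := [set v | C v /\ `|x - v| ^+ 2 < inf D + e].
pose F := filter_from [set e : R | 0 < e] S.
have FF : ProperFilter F.
  apply: filter_from_proper => [|e e0]; last first.
    by have [_ [v Cv <-] ve] := inf_adherent e0 infD; exists v.
  apply: filter_from_filter; first by exists 1 => /=.
  move=> e d /= e0 d0; exists (Num.min e d); first by rewrite lt_min e0.
  move=> v [Cv vlt]; split; split=> //; apply: (lt_le_trans vlt).
    by rewrite lerD2l ge_min lexx.
  by rewrite lerD2l ge_min lexx orbT.
have Fcvg : cvg F.
  apply: cauchy_cvg; apply: cauchy_exP => e e0.
  (* two points of S (e^2 / 4) are at squared distance less than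
     4 * (e^2 / 4) = e^2 *)
  have e4 : 0 < e ^+ 2 / 4 by rewrite divr_gt0 ?exprn_gt0.
  have [_ [v Cv <-] ve] := inf_adherent e4 infD.
  exists v; exists (e ^+ 2 / 4) => // w [Cw we].
  rewrite -ball_normE /ball_/= -(@ltr_pXn2r _ 2) ?nnegrE ?(ltW e0)//.
  have mid : 4 * `|x - 2^-1 *: (v + w)| ^+ 2 = `|(x - v) + (x - w)| ^+ 2.
    rewrite (_ : (x - v) + (x - w) = 2%:R *: (x - 2^-1 *: (v + w))).
      by rewrite normrZ exprMn normr_nat -natrX.
    by rewrite scalerBr scalerA divff// scale1r scaler_nat mulr2n addrACA opprD.
  have := lbD _ (midC _ _ Cv Cw).
  have -> : v - w = (x - w) - (x - v) by rewrite opprB [RHS]addrC subrKA.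
  move: mid we ve; rewrite (sqr_normD (x - v)) (sqr_normB (x - w)) (dotC ip (x - w)).
  move: (`|x - 2^-1 *: _| ^+ 2) (`|x - v| ^+ 2) (`|x - w| ^+ 2) => m a b.
  by move: (ip _ _) (inf D) => d i; lra.
pose p := lim F; have Fp : F --> p by exact: Fcvg.
have Cp : C p.
  apply: (@closed_cvg _ _ F FF id C clC _ p) => //.
  by exists 1 => //= v [].
exists p; split=> // v Cv.
rewrite -(@ler_pXn2r _ 2) ?nnegrE//; apply: le_trans (lbD v Cv).
apply/ler_addgt0Pr => e e0.
pose f w : R := `|x - w| ^+ 2.
apply: (@closed_cvg _ _ F FF f [set r | r <= inf D + e]).
- exact: closed_le.
- by exists e => //= w [_ /ltW].
- rewrite /f expr2; under eq_fun do rewrite expr2.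
  have xF : `|x - w| @[w --> F] --> `|x - p|.
    by apply: cvg_norm; apply: cvgB; [exact: cvg_cst|exact: Fp].
  exact: cvgM.
Qed.

(** Moving from [p] in a direction [v] of [V] cannot decrease the distance to
    [x], so the first order term [ip (x - p) v] vanishes. *)
Lemma nearest_orth V x p : linear_subspace V -> V p ->
  (forall v, V v -> `|x - p| <= `|x - v|) -> orth ip V (x - p).
Proof.
move=> VS Vp pmin v Vv.
set b := ip (x - p) v; set c := `|v| ^+ 2.
have c0 : 0 <= c by apply: sqr_ge0.
(* the optimal step is b / c; adding 1 avoids the case v = 0 and is still short
   enough to decrease the distance unless b = 0 *)
pose t := b / (c + 1).
have : `|x - p| ^+ 2 <= `|(x - p) - t *: v| ^+ 2.
  rewrite ler_pXn2r ?nnegrE// -addrA -opprD; apply: pmin.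
  by apply: linear_subspaceD => //; apply: linear_subspace_scale.
rewrite (sqr_normB (x - p)) linearZr_LR /= normrZ exprMn -/b -/c.
rewrite real_normK ?num_real//.
have bE : b = t * (c + 1) by rewrite /t mulfVK// lt0r_neq0// ltr_wpDl.
rewrite -mulr_natl bE; move: (`|x - p| ^+ 2) c c0 t {bE} => a c c0 t H.
have t0 : t = 0 by apply/eqP; rewrite -sqrf_eq0 eq_le sqr_ge0 andbT; nra.
by rewrite t0 mul0r.
Qed.

Lemma metric_projP V x : linear_subspace V -> closed V ->
  V (metric_proj V x) /\ orth ip V (x - metric_proj V x).
Proof.
move=> VS clV.
have [p pP] : exists p, V p /\ forall v, V v -> `|x - p| <= `|x - v|.
  apply: exists_nearest => //; first by exists 0; case/linear_subspaceP: VS.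
  move=> u v Vu Vv; apply: (linear_subspace_scale _ VS).
  exact: linear_subspaceD.
rewrite /metric_proj; case: xgetP => [q _ [Vq qmin]|/(_ p)//].
by split=> //; apply: nearest_orth.
Qed.

Lemma metric_proj_in V x : linear_subspace V -> closed V -> V (metric_proj V x).
Proof. by move=> VS clV; have [] := metric_projP x VS clV. Qed.

(** Two candidates differ by a vector of [V] orthogonal to [V].  This
    characterization is how values of the projection are computed below. *)
Lemma metric_proj_unique V x p : linear_subspace V -> closed V ->
  V p -> orth ip V (x - p) -> metric_proj V x = p.
Proof.
move=> VS clV Vp xp; have [Vq xq] := metric_projP x VS clV.
apply/subr0_eq/(@orth_disjoint _ _ ip V); first exact: linear_subspaceB.
rewrite (_ : _ - p = (x - p) - (x - metric_proj V x)).
  exact: (linear_subspaceB (orth_subspace ip V)).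
by rewrite opprB [RHS]addrC subrKA.
Qed.

Lemma metric_proj_linear V (a : R) x y : linear_subspace V -> closed V ->
  metric_proj V (a *: x + y) = a *: metric_proj V x + metric_proj V y.
Proof.
move=> VS clV.
have [Vx xV] := metric_projP x VS clV; have [Vy yV] := metric_projP y VS clV.
apply: metric_proj_unique => //; first by case/linear_subspaceP: VS => _; apply.
rewrite opprD addrACA -scalerBr.
by case/linear_subspaceP: (orth_subspace ip V) => _; apply.
Qed.

Lemma metric_proj_id V x : linear_subspace V -> closed V -> V x ->
  metric_proj V x = x.
Proof.
move=> VS clV Vx; apply: metric_proj_unique => //.
by rewrite subrr; case/linear_subspaceP: (orth_subspace ip V).
Qed.

(** This is what lets [P_V] be inserted in or removed from the second argument
    of the monotonicity inequality between points of [V]. *)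
Lemma dot_metric_proj V x y : linear_subspace V -> closed V -> V x ->
  ip x (metric_proj V y) = ip x y.
Proof.
move=> VS clV Vx; have [_ /(_ _ Vx)] := metric_projP y VS clV.
by rewrite dotC linearBr => /subr0_eq.
Qed.

(** For [x] bi-orthogonal to [V], the remainder of its projection on the
    closure of [V] is both orthogonal and bi-orthogonal to [V], hence zero. *)
Lemma orth_orth V : linear_subspace V -> orth ip (orth ip V) = closure V.
Proof.
move=> VS; have WS := closure_subspace VS; have clW := @closed_closure _ V.
have WVV : closure V `<=` orth ip (orth ip V).
  by rewrite closureE; apply: smallest_sub; [exact: orth_closed|exact: orth_sym].
apply/seteqP; split=> // x xVV; have [Wp xp] := metric_projP x WS clW.
suff /subr0_eq -> : x - metric_proj (closure V) x = 0 by [].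
have xpV : orth ip V (x - metric_proj (closure V) x).
  by apply: orthS xp; apply: subset_closure.
apply: (orth_disjoint xpV).
exact: (linear_subspaceB (orth_subspace ip _) xVV (WVV _ Wp)).
Qed.

End HilbertProjection.

(** * Linear relations and monotonicity *)

Section LinearRelations.
Variables (R : realType) (X : lmodType R) (ip : {dot X for idfun}).
Implicit Types (A T : X -> set X) (x y u v w : X).

Lemma graP T x u : gra T (x, u) <-> T x u.
Proof. by split=> [[]//|Txu]; split=> //; exists u. Qed.

Lemma linear_relation_gra A (a : R) x y u v : linear_relation A ->
  A x u -> A y v -> A (a *: x + y) (a *: u + v).
Proof.
move=> [/linear_subspaceP[_ domL] AZ AD] Axu Ayv.
have domA z w : A z w -> dom A z by move=> Azw; exists w.
have Aaxu : A (a *: x) (a *: u) by apply: AZ (domA _ _ Axu) _ _; exists u.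
apply: AD (domA _ _ Aaxu) (domA _ _ Ayv) _ _.
by exists (a *: u) => //; exists v.
Qed.

Lemma linear_relation00 A : linear_relation A -> A 0 0.
Proof.
move=> AL; have [/linear_subspaceP[[u A0u] _] _ _] := AL.
have := linear_relation_gra (-1) AL A0u A0u.
by rewrite scaler0 addr0 scaleN1r addNr.
Qed.

Lemma linear_relation_scale A (a : R) x u : linear_relation A ->
  A x u -> A (a *: x) (a *: u).
Proof.
move=> AL Axu; have := linear_relation_gra a AL Axu (linear_relation00 AL).
by rewrite !addr0.
Qed.

Lemma linear_relationB A x y u v : linear_relation A ->
  A x u -> A y v -> A (x - y) (u - v).
Proof.
move=> AL Axu Ayv; have := linear_relation_gra (-1) AL Ayv Axu.
by rewrite !scaleN1r ![- _ + _]addrC.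
Qed.

Lemma value0_subspace A : linear_relation A -> linear_subspace (A 0).
Proof.
move=> AL; apply/linear_subspaceP; split; first exact: linear_relation00.
move=> a u v A0u A0v; have := linear_relation_gra a AL A0u A0v.
by rewrite scaler0 addr0.
Qed.

(** [s *: u] runs through [A 0] with [u], so the affine function
    [s |-> ip x v - s * ip x u] is nonnegative on the whole line. *)
Lemma value0_sub_orth_dom A : linear_relation A -> monotone_op ip A ->
  A 0 `<=` orth ip (dom A).
Proof.
move=> AL Am u A0u x [v Axv]; rewrite dotC; apply/eqP; apply: contraT => xu0.
(* the point where the affine function takes the value -1 *)
pose s := (ip x v + 1) / ip x u.
have A0su : A 0 (s *: u).
  by have := linear_relation_scale s AL A0u; rewrite scaler0.
have /graP gx := Axv; have /graP g0 := A0su.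
have := Am _ _ _ _ gx g0; rewrite subr0 linearBr linearZr_LR /= divfK//.
by rewrite opprD addrA subrr sub0r ler0N1.
Qed.

(** Adjoining the single pair [(x, u)] to the graph is a monotone extension. *)
Lemma maximal_monotone_related A x u : maximal_monotone ip A ->
  (forall y v, A y v -> 0 <= ip (x - y) (u - v)) -> A x u.
Proof.
move=> [_ Am Amax] xuA.
pose T : X -> set X := fun y => [set v | A y v \/ (y, v) = (x, u)].
have Tm : monotone_op ip T.
  move=> y v z w /graP[Ayv|[-> ->]] /graP[Azw|[-> ->]].
  - by apply: Am; apply/graP.
  - by rewrite -opprB -[v - u]opprB linearNl linearNr /= opprK; apply: xuA.
  - exact: xuA.
  - by rewrite subrr linear0l.
have AT : gra A `<=` gra T by move=> [y v] /graP Ayv; apply/graP; left.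
apply/graP; rewrite -(Amax T _ Tm AT) //.
by apply/graP; right.
Qed.

(** For [w] orthogonal to [dom A], relatedness of [(0, w)] to [(x, v)] reduces
    to [0 <= ip x v], which is monotonicity between [(x, v)] and [(0, 0)]. *)
Lemma maximal_value0 A : linear_relation A -> maximal_monotone ip A ->
  A 0 = orth ip (dom A).
Proof.
move=> AL Amax; have [_ Am _] := Amax.
apply/seteqP; split; first exact: value0_sub_orth_dom.
move=> w wA; apply: maximal_monotone_related => // x v Axv.
have domx : dom A x by exists v.
have /graP gx := Axv; have /graP g0 := linear_relation00 AL.
have := Am _ _ _ _ gx g0.
by rewrite !subr0 sub0r linearNl linearBr /= (dotC ip x w) wA// sub0r opprK.
Qed.

End LinearRelations.

(** * The projected operator *)

Section ProjectedOperator.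
Variables (R : realType) (X : completeNormedModType R).
Variables (ip : {dot X for idfun}) (normE : forall x : X, `|x| ^+ 2 = ip x x).
Variables (A : X -> set X) (AL : linear_relation A).
Implicit Types (V : set X) (x u : X).

Lemma dom_proj_op V : dom (proj_op V A) = dom A.
Proof.
apply/seteqP; split=> x; first by move=> [_ [u Axu _]]; exists u.
by move=> [u Axu]; exists (metric_proj V u), u.
Qed.

Lemma proj_op_operator_on V : linear_subspace V -> closed V -> dom A `<=` V ->
  operator_on V (proj_op V A).
Proof.
move=> VS clV domV [x p] /graP[u Axu <-]; split=> /=.
  by apply: domV; exists u.
exact: (metric_proj_in normE).
Qed.

Lemma proj_op_single_valued V : linear_subspace V -> closed V ->
  A 0 `<=` orth ip V -> single_valued (proj_op V A).
Proof.
move=> VS clV A0V x _ _ [u Axu <-] [v Axv <-].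
have [Vp vp] := metric_projP normE v VS clV.
apply: (metric_proj_unique normE) => //.
rewrite -(subrKA v); apply: (linear_subspaceD (orth_subspace ip V)) => //.
by apply: A0V; rewrite -(subrr x); apply: linear_relationB.
Qed.

Lemma proj_op_monotone V : monotone_op ip A -> linear_subspace V -> closed V ->
  dom A `<=` V -> monotone_op ip (proj_op V A).
Proof.
move=> Am VS clV domV x _ y _ /graP[u Axu <-] /graP[v Ayv <-].
have Vxy : V (x - y).
  by apply: linear_subspaceB => //; apply: domV; [exists u|exists v].
rewrite linearBr /= !(dot_metric_proj normE)// -linearBr.
by apply: Am; apply/graP.
Qed.

Lemma proj_op_linear V : linear_subspace V -> closed V ->
  linear_relation (proj_op V A).
Proof.
move=> VS clV; split; first by rewrite dom_proj_op; case: AL.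
  move=> a x _ _ [_ [u Axu <-] <-]; exists (a *: u).
    exact: linear_relation_scale.
  rewrite -[a *: u]addr0 (metric_proj_linear normE)//.
  rewrite (metric_proj_id (x := 0) normE VS clV) ?addr0 //.
  by case/linear_subspaceP: VS.
move=> x y _ _ _ [_ [u Axu <-] [_ [v Ayv <-] <-]]; exists (u + v).
  by have := linear_relation_gra 1 AL Axu Ayv; rewrite !scale1r.
by rewrite -[u]scale1r (metric_proj_linear normE)// !scale1r.
Qed.

(** As [A 0] is its own bi-orthogonal, the remainder [u - P_V u] belongs to
    [A 0], and [P_V u] differs from [u] by it. *)
Lemma proj_op_selection : closed (A 0) ->
  selection (proj_op (orth ip (A 0)) A) A.
Proof.
move=> clA0 [x _] /graP[u Axu <-]; apply/graP; set V := orth ip (A 0).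
have VS : linear_subspace V by apply: orth_subspace.
have clV : closed V by apply: orth_closed.
have A0VV : orth ip V = A 0.
  rewrite (orth_orth normE); last exact: value0_subspace.
  exact/esym/closure_id.
have [_] := metric_projP normE u VS clV; rewrite A0VV => A0up.
by have := linear_relationB AL Axu A0up; rewrite subr0 subKr.
Qed.

(** A monotone extension of the projected operator within [V] is monotonically
    related to [A] itself, so maximality of [A] puts its graph in that of [A];
    and [P_V] fixes the values that already lie in [V]. *)
Lemma proj_op_maximal V : maximal_monotone ip A ->
  linear_subspace V -> closed V -> dom A `<=` V ->
  maximal_monotone_on ip V (proj_op V A).
Proof.
move=> Amax VS clV domV; have [_ Am _] := Amax; split.
- exact: proj_op_operator_on.
- exact: proj_op_monotone.
- move=> T TV Tm AT; apply/seteqP; split=> // -[x u] gT.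
  have [/= Vx Vu] := TV _ gT.
  apply/graP; exists u; last exact: (metric_proj_id normE).
  apply: maximal_monotone_related Amax _ => y v Ayv.
  have Vxy : V (x - y) by apply: linear_subspaceB => //; apply: domV; exists v.
  rewrite linearBr /= -(dot_metric_proj normE v VS clV Vxy) -linearBr.
  by apply: Tm gT (AT (y, _) _); apply/graP; exists v.
Qed.

End ProjectedOperator.

Theorem proposition4p9 (R : realType) (X : completeNormedModType R)
    (ip : {dot X for idfun}) (normE : forall x : X, `|x| ^+ 2 = ip x x)
    (A : X -> set X) (Amono : monotone_op ip A) (Alin : linear_relation A) :
  (forall V : set X, admissible ip A V ->
    [/\ operator_on V (proj_op V A),
        dom (proj_op V A) = dom A,
        single_valued (proj_op V A),
        monotone_op ip (proj_op V A) &
        linear_relation (proj_op V A)] /\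
    (V = orth ip (A 0) -> closed (A 0) ->
      single_valued (proj_op V A) /\ selection (proj_op V A) A)) /\
  (maximal_monotone ip A ->
    [/\ orth ip (A 0) = closure (dom A),
        admissible ip A (orth ip (A 0)),
        forall W : set X, admissible ip A W -> W = orth ip (A 0) &
        let V := orth ip (A 0) in
        [/\ maximal_monotone_on ip V (proj_op V A),
            single_valued (proj_op V A) &
            selection (proj_op V A) A]]).
Proof.
split.
  move=> V [[VS clV] domV A0V]; split; first split.
  - exact: (proj_op_operator_on normE).
  - exact: dom_proj_op.
  - exact: (proj_op_single_valued normE).
  - exact: (proj_op_monotone normE).
  - exact: (proj_op_linear normE).
  move=> VE clA0; split; first exact: (proj_op_single_valued normE).
  by rewrite VE; apply: (proj_op_selection normE).
move=> Amax; have A0E := maximal_value0 Alin Amax.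
have domS : linear_subspace (dom A) by case: Alin.
have VE : orth ip (A 0) = closure (dom A) by rewrite A0E (orth_orth normE).
have VS := orth_subspace ip (A 0).
have clV : closed (orth ip (A 0)) by apply: (orth_closed normE).
have domV : dom A `<=` orth ip (A 0) by rewrite VE; apply: subset_closure.
have A0V : A 0 `<=` orth ip (orth ip (A 0)) by apply: orth_sym.
split=> //.
- move=> W [[WS clW] domW A0W]; apply/seteqP; split; first exact: orth_sym.
  by rewrite VE closureE; apply: smallest_sub.
- split; first exact: (proj_op_maximal normE).
  + exact: (proj_op_single_valued normE).
  + by apply: (proj_op_selection normE) => //; rewrite A0E;
      apply: (orth_closed normE).
Qed.
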